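(* Let $S$ be a semilattice-ordered semigroup and let $\mathrm{cl}$ be an algebraic closure operator on $S$. Let $X=\{A\in\mathcal{P}(S)\mid A^{\mathrm{cl}}=A\}$, and let $\star:X\times X\to X$ be given by $A\star B=(AB)^{\mathrm{cl}}$. Then the following conditions are equivalent: (1) the map $\star:X\times X\to X$ is spectral; (2) the map $\star:X^{\mathrm{cons}}\times X^{\mathrm{cons}}\to X^{\mathrm{cons}}$ is continuous; (3) for every finite subset $F\subseteq S$ there exists a finite (possibly empty) family of pairs $(G_i,H_i)\in\mathcal{P}_{\mathrm{fin}}(S)\times\mathcal{P}_{\mathrm{fin}}(S)$, $i\in I$, such that for all $A,B\in X$, $$F\subseteq A\star B\iff \exists i\in I\text{ such that }G_i\subseteq A\text{ and }H_i\subseteq B;$$ (4) for every finite subset $F\subseteq S$ there exists a finite (possibly empty) family of pairs $(G_i,H_i)\in X_{\mathrm{fin}}\times X_{\mathrm{fin}}$, $i\in I$, such that for all $A,B\in X_{\mathrm{fin}}$, $$F\subseteq A\star B\iff \exists i\in I\text{ such that }G_i\subseteq A\text{ and }H_i\subseteq B.$$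
   Context: A semilattice-ordered semigroup is a triple $(S,\cdot,\lor)$ with $S$ nonempty, $(S,\cdot)$ a semigroup, $(S,\lor)$ a semilattice (commutative, associative, idempotent), and $x(y\lor z)=xy\lor xz$, $(x\lor y)z=xz\lor yz$ for all $x,y,z\in S$. For $A,B\subseteq S$, $AB=\{ab\mid a\in A,b\in B\}$. $\mathcal{P}(S)$ is the power set of $S$ and $\mathcal{P}_{\mathrm{fin}}(A)$ is the set of finite subsets of $A$. A closure operator on $S$ is a map $\mathrm{cl}:\mathcal{P}(S)\to\mathcal{P}(S)$, written $A\mapsto A^{\mathrm{cl}}$, which is extensive, idempotent and order-preserving for inclusion. It is algebraic if $A^{\mathrm{cl}}=\bigcup\{F^{\mathrm{cl}}\mid F\in\mathcal{P}_{\mathrm{fin}}(A)\}$ for every $A\subseteq S$. $X_{\mathrm{fin}}=\{F^{\mathrm{cl}}\mid F\in\mathcal{P}_{\mathrm{fin}}(S)\}\subseteq X$ is the family of finitely generated closed subsets. The hull-kernel topology on $\mathcal{P}(S)$ has open subbasis $D(F)=\{A\in\mathcal{P}(S)\mid F\nsubseteq A\}$, $F\in\mathcal{P}_{\mathrm{fin}}(S)$. $X$ carries the subspace topology; since $\mathrm{cl}$ is algebraic, $X$ is a spectral space (quasi-compact, $T_0$, sober, with quasi-compact opens closed under finite intersections and forming a basis), and $X\times X$ with the product topology is a spectral space. A map between spectral spaces is spectral if the preimage of every quasi-compact open set is quasi-compact and open. $X^{\mathrm{cons}}$ denotes $X$ with the patch (constructible) topology, the coarsest topology for which all quasi-compact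 open subsets of $X$ are clopen; $X^{\mathrm{cons}}\times X^{\mathrm{cons}}$ has the product topology. *)

(* Defs.v *)
From HB Require Import structures.
From mathcomp Require Import all_boot all_order.
From mathcomp Require Import all_classical.
From mathcomp Require Import topology_structure compact initial_topology
  product_topology subtype_topology.
Set Implicit Arguments.
Unset Strict Implicit.
Unset Printing Implicit Defensive.

Local Open Scope classical_set_scope.

(* The semilattice operation is the library's binary join; the induced order
   is the usual one, x <= y iff x join y = y. *)
HB.mixin Record isSemilatticeOrderedSemigroup (d : Order.disp_t) S
    of Order.JoinSemilattice d S & Semigroup S := {
  slos_nonempty : inhabited S;
  mulg_joinr : forall x y z : S,
    (x * Order.join y z)%g = Order.join (x * y)%g (x * z)%g;
  mulg_joinl : forall x y z : S,
    (Order.join x y * z)%g = Order.join (x * z)%g (y * z)%g }.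

#[short(type="slosType")]
HB.structure Definition SemilatticeOrderedSemigroup (d : Order.disp_t) :=
  {S of Order.JoinSemilattice d S & Semigroup S
      & isSemilatticeOrderedSemigroup d S}.

Definition set_mulg {S : semigroupType} (A B : set S) : set S :=
  [set (a * b)%g | a in A & b in B].

Record closure_operator (S : Type) := ClosureOperator {
  cl_fun :> set S -> set S;
  cl_extensive : forall A, A `<=` cl_fun A;
  cl_idempotent : forall A, cl_fun (cl_fun A) = cl_fun A;
  cl_monotone : forall A B, A `<=` B -> cl_fun A `<=` cl_fun B }.

Definition algebraic_closure (S : Type) (cl : closure_operator S) : Prop :=
  forall A, cl A = \bigcup_(F in [set F | finite_set F /\ F `<=` A]) cl F.

(* [hull_kernel S] is the power set of [S] as a type of its own, so that its
   topology is kept apart from any library structure on [set S]. *)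
Definition hull_kernel (S : Type) : Type := set S.
HB.instance Definition _ (S : Type) := Choice.copy (hull_kernel S) (set S).
HB.instance Definition _ (S : Type) :=
  @isSubBaseTopological.Build (hull_kernel S) (set S)
    [set F | finite_set F]
    (fun F => [set A : hull_kernel S | ~ (F `<=` (A : set S))]).

Definition closed_sets (S : Type) (cl : closure_operator S)
  : set (hull_kernel S) := [set A | cl A = A].

(* The coercion of a set to a subtype gives the type of closed subsets, and
   the library equips it with the subspace topology. *)
Definition closed_space (S : Type) (cl : closure_operator S)
  : topologicalType := closed_sets cl.

Definition carrier {S : Type} {cl : closure_operator S}
  (A : closed_space cl) : set S := set_val A.

Definition fin_generated (S : Type) (cl : closure_operator S)
  : set (closed_space cl) :=
  [set A | exists2 F, finite_set F & carrier A = cl F].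

Definition mk_closed (S : Type) (cl : closure_operator S) (A : set S)
  : closed_space cl := exist _ (cl A) (mem_set (cl_idempotent cl A)).

Definition star (S : semigroupType) (cl : closure_operator S)
    (AB : closed_space cl * closed_space cl) : closed_space cl :=
  mk_closed cl (set_mulg (carrier AB.1) (carrier AB.2)).

(* The library's [compact] has no separation condition: it is
   quasi-compactness. *)
Definition qc_open {T : topologicalType} (U : set T) : Prop :=
  open U /\ compact U.

Definition spectral_map {T U : topologicalType} (f : T -> U) : Prop :=
  forall V : set U, qc_open V -> qc_open (f @^-1` V).

(* The coarsest topology making the quasi-compact opens clopen is the one with
   subbasis the quasi-compact opens and their complements. *)
Definition patch_space (T : topologicalType) : Type := T.
HB.instance Definition _ (T : topologicalType) := Choice.copy (patch_space T) T.
HB.instance Definition _ (T : topologicalType) :=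
  @isSubBaseTopological.Build (patch_space T) (set T)
    [set U : set T | qc_open U \/ qc_open (~` U)] id.

(* Main.v *)
Require Import Defs.
From HB Require Import structures.
From mathcomp Require Import all_boot all_order finmap.
From mathcomp Require Import all_classical.
From mathcomp Require Import topology_structure compact initial_topology
  product_topology subtype_topology.
Local Open Scope classical_set_scope.

(** Write X for the space of closed subsets and, for a finite subset F of S,
    [above F] for the set of all A in X containing F. The whole argument is
    about these sets and the rectangles [above G `*` above H] they define in
    X * X. Condition (3) says exactly that the preimage under [star] of each
    [above F] is a finite union of such rectangles ([above_prodP]).

    The key fact is a compactness principle: since [cl] is algebraic, along any
    ultrafilter on X the set of those s with [above [set s]] in the ultrafilter
    is again closed, so every ultrafilter has a limit p for which membership
    of [above F] in the ultrafilter is decided by whether p lies in [above F].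
    The property passes to rectangles in X * X by pushing ultrafilters along
    the projections. A family of closed sets with this property is called
    a [coherent_base] when it is stable under finite intersections and the
    complements of its finite unions form a base of the topology. It determines
    the quasi-compact opens, which are the complements of finite unions of its
    members ([qc_openP]), and it makes the patch topology compact
    ([patch_compact]).

    A map is therefore spectral iff it pulls the base of its target back to
    finite unions of members of the base of its source ([spectral_mapP]), which
    is the equivalence of (1) and (3). Members of a base being clopen for the
    patch topology, a spectral map is patch-continuous
    ([spectral_patch_continuous]), so (1) implies (2). Conversely, if [star] is
    patch-continuous, the preimage of [above F] is clopen for the product
    of the patch topologies, and it is an up-set for inclusion because [star] is
    monotone; compactness then makes it a finite union of rectangles
    ([clopen_upset]), which gives (3).

    Finally (3) and (4) are exchanged by replacing finite sets by their closures
    and closed sets by finite generating sets; the passage from finitely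
    generated to arbitrary A and B is possible because a finite part of
    [star (A, B)] already lies in the product of finitely generated subsets of A
    and B ([sub_star_fin]). *)

Set Implicit Arguments.
Unset Strict Implicit.
Unset Printing Implicit Defensive.

(** * Ultrafilters and finite subcovers *)

Lemma ultra_setC (T : Type) (F : set_system T) (A : set T) :
  UltraFilter F -> F (~` A) <-> ~ F A.
Proof.
move=> FU; split=> [FnA FA|nFA]; last by case: (in_ultra_setVsetC A FU).
by have /filter_ex[x []] : F (A `&` ~` A) by exact: filterI.
Qed.

Lemma ultra_fmap (T U : Type) (f : T -> U) (F : set_system T) :
  UltraFilter F -> UltraFilter (f @ F).
Proof.
move=> FU; split=> [|G GF sFG]; first exact: fmap_proper_filter.
apply/seteqP; split=> [A GA|A /sFG //].
have [//|nA] := in_ultra_setVsetC (f @^-1` A) FU.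
have /filter_ex[x []] // : G (A `&` ~` A).
by apply: filterI => //; exact: sFG.
Qed.

Lemma compact_open_subcover (T : topologicalType) (A : set T)
    (O : set (set T)) :
  compact A -> O `<=` open -> A `<=` \bigcup_(U in O) U ->
  exists O' : set (set T),
    [/\ finite_set O', O' `<=` O & A `<=` \bigcup_(U in O') U].
Proof.
have [->|/set0P[p Ap]] := eqVneq A set0.
  by exists set0; split=> // x [].
(* The covering criterion for compactness asks for a pointed space. *)
pose T' : ptopologicalType :=
  HB.pack (Topological.sort T) (isPointed.Build T p).
move=> cA oO cov; have : @compact T' A by exact: cA.
rewrite compact_cover => /(_ _ O id oO cov)[D sD covD].
by exists [set` D]; split=> [|U /sD /set_mem|]; [exact: finite_fset| |].
Qed.

Lemma filter_bigcap (T I : Type) (F : set_system T) (E : set I)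
    (f : I -> set T) : Filter F -> finite_set E ->
  (forall i, E i -> F (f i)) -> F (\bigcap_(i in E) f i).
Proof.
elim/Pchoice: I => I in E f *.
move=> FF /finite_fsetP[X ->] FX; exact: filter_bigI.
Qed.

(** * Finite unions of members of a family *)

Lemma bigcap_setI_closed (T : Type) (P : set (set T)) (E : set (set T)) :
  P setT -> setI_closed P -> finite_set E -> E `<=` P -> P (\bigcap_(C in E) C).
Proof.
move=> PT PI /finite_seqP[s ->]; rewrite bigcap_seq.
elim: s => [|C s IHs] sP; first by rewrite big_nil.
rewrite big_cons; apply: PI; first by apply: sP; rewrite /= inE eqxx.
by apply: IHs => D sD; apply: sP; rewrite /= inE sD orbT.
Qed.

Definition fin_union (T : Type) (B : set (set T)) (C : set T) : Prop :=
  exists E, [/\ finite_set E, E `<=` B & C = \bigcup_(V in E) V].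

Section FinUnion.
Context {T : Type} (B : set (set T)).

Lemma fin_union1 V : B V -> fin_union B V.
Proof.
by move=> BV; exists [set V]; split; [|move=> _ ->|rewrite bigcup_set1].
Qed.

Lemma fin_union_bigcup (I : Type) (D : set I) (f : I -> set T) :
  finite_set D -> (forall i, D i -> fin_union B (f i)) ->
  fin_union B (\bigcup_(i in D) f i).
Proof.
move=> finD fB.
have /choice[E EP] i : exists E, D i ->
    [/\ finite_set E, E `<=` B & f i = \bigcup_(V in E) V].
  have [/fB[E ?]|nDi] := pselect (D i); first by exists E.
  by exists set0 => /nDi.
exists (\bigcup_(i in D) E i); split.
- by apply: bigcup_finite => // i /EP[].
- by move=> V [i /EP[_ sEB _] /sEB].
- rewrite bigcup_bigcup.
  by apply: eq_bigcupr => i /EP[].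
Qed.

Lemma fin_unionU C D :
  fin_union B C -> fin_union B D -> fin_union B (C `|` D).
Proof.
move=> CB DB; rewrite -bigcup2inE.
by apply: fin_union_bigcup; [exact: finite_II|case=> [|[|]]].
Qed.

Lemma fin_unionI : setI_closed B -> setI_closed (fin_union B).
Proof.
move=> BI _ _ [E [finE sE ->]] [E' [finE' sE' ->]].
rewrite setI_bigcupl; apply: fin_union_bigcup => // V EV.
rewrite setI_bigcupr; apply: fin_union_bigcup => // W E'W.
by apply: fin_union1; apply: BI; [exact: sE|exact: sE'].
Qed.

End FinUnion.

(** * Coherent bases and quasi-compact open sets *)

(** The members of [B] are to be thought of as basic closed sets with
    quasi-compact complement. The last field packages all the compactness in
    use: it says that the topology generated by the members of [B] and their
    complements is compact, and [base_nbhs] is what turns it into statements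
    about the given topology. *)
Record coherent_base (T : topologicalType) (B : set (set T)) : Prop :=
  CoherentBase {
    base_setT : B setT;
    base_setI : setI_closed B;
    base_closed : B `<=` closed;
    base_nbhs : forall (p : T) (U : set T), nbhs p U ->
      exists C, [/\ fin_union B C, ~ C p & ~` C `<=` U];
    base_limit : forall F : set_system T, UltraFilter F ->
      exists p, forall V, B V -> F V <-> V p }.

Definition prod_base (T U : Type) (B : set (set T)) (B' : set (set U)) :
  set (set (T * U)) := [set V `*` W | V in B & W in B'].

Lemma fin_union_setX (T U : Type) (B : set (set T)) (B' : set (set U)) C D :
  fin_union B C -> fin_union B' D -> fin_union (prod_base B B') (C `*` D).
Proof.
move=> [E [finE sE ->]] [E' [finE' sE' ->]].
rewrite setX_bigcupl; apply: fin_union_bigcup => // V /sE BV.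
rewrite setX_bigcupr; apply: fin_union_bigcup => // W /sE' B'W.
by apply: fin_union1; exists V => //; exists W.
Qed.

Section CoherentBase.
Context {T : topologicalType} (B : set (set T)) (cB : coherent_base B).

Lemma fin_union_closed C : fin_union B C -> closed C.
Proof.
move=> [E [finE sE ->]]; apply: closed_bigcup => // V /sE.
exact: base_closed.
Qed.

(** An ultrafilter contains a finite union only if it contains one of the
    terms, so the defining property of a limit extends from the base to finite
    unions. *)
Lemma ultra_fin_union (F : set_system T) (p : T) C : UltraFilter F ->
  (forall V, B V -> F V <-> V p) -> fin_union B C -> F C <-> C p.
Proof.
move=> FU Fp [E [finE sE ->]]; split=> [FE|[V EV Vp]]; last first.
  by apply: (@filterS _ _ _ V); [exact: bigcup_sup|apply/Fp => //; exact: sE].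
apply: contrapT => nEp.
have FnE : F (~` \bigcup_(V in E) V).
  rewrite setC_bigcup; apply: filter_bigcap => // V EV.
  by apply/ultra_setC => /Fp Vp; apply: nEp; exists V => //; exact/Vp/sE.
by have /ultra_setC[] := FnE.
Qed.

(** A quasi-compact open set is covered by finitely many of the basic open sets
    inside it, and the complement of their union is a finite intersection of
    finite unions, which distributes. Conversely a limit of an ultrafilter
    containing [U] cannot lie in the complement of [U], and is a limit for the
    topology because the complements of finite unions form a neighbourhood
    base. *)
Lemma qc_openP (U : set T) : qc_open U <-> fin_union B (~` U).
Proof.
split=> [[oU cU]|BU].
  pose O := [set W | [/\ W `<=` U, open W & fin_union B (~` W)]].
  have cov : U `<=` \bigcup_(W in O) W.
    move=> p Up; have /(base_nbhs cB)[C [BC nCp sCU]] : nbhs p U.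
      exact: open_nbhs_nbhs.
    exists (~` C) => //; split=> //; last by rewrite setCK.
    by rewrite openC; exact: fin_union_closed.
  have oO : O `<=` open by move=> W [].
  have [O' [finO' sO' covO']] := compact_open_subcover cU oO cov.
  have -> : U = \bigcup_(W in O') W.
    by apply/seteqP; split=> // p [W /sO'[sWU _ _] /sWU].
  rewrite setC_bigcup.
  have -> : \bigcap_(W in O') ~` W = \bigcap_(C in setC @` O') C.
    by rewrite bigcap_image.
  apply: bigcap_setI_closed.
  - exact/fin_union1/(base_setT cB).
  - exact/fin_unionI/(base_setI cB).
  - exact: finite_image.
  - by move=> _ [W /sO'[_ _ ?] <-].
split; first by rewrite -closedC; exact: fin_union_closed.
rewrite compact_ultra => F FU FW; have [p Fp] := base_limit cB FU.
have limF C : fin_union B C -> F C <-> C p by exact: ultra_fin_union.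
exists p; split=> [|W /(base_nbhs cB)[C [BC nCp sCW]]].
  by apply: contrapT => /(limF _ BU)/ultra_setC[].
by apply: filterS sCW _; apply/ultra_setC => /(limF _ BC).
Qed.

End CoherentBase.

(** The complement of a rectangle [C `*` D] is not a rectangle; a box
    neighbourhood is reached instead as the complement of the finite union
    [C `*` setT `|` setT `*` C'], a use of [setT] being in both bases.
    The limit of an ultrafilter on the product is the pair of the limits of
    its two projections. *)
Lemma coherent_prod_base (T U : topologicalType) (B : set (set T))
    (B' : set (set U)) :
  coherent_base B -> coherent_base B' -> coherent_base (prod_base B B').
Proof.
move=> cB cB'; split.
- exists setT; first exact: base_setT.
  by exists setT; [exact: base_setT|rewrite setXTT].
- move=> _ _ [V BV [W B'W <-]] [V' BV' [W' B'W' <-]]; rewrite -setXI.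
  exists (V `&` V'); first exact: base_setI.
  by exists (W `&` W') => //; exact: base_setI.
- move=> _ [V BV [W B'W <-]].
  have -> : V `*` W = fst @^-1` V `&` snd @^-1` W by [].
  apply: closedI.
    have /continuous_closedP cfst : continuous (@fst T U).
      by move=> p; exact: cvg_fst.
    by apply: cfst; exact: (base_closed cB).
  have /continuous_closedP csnd : continuous (@snd T U).
    by move=> p; exact: cvg_snd.
  by apply: csnd; exact: (base_closed cB').
- move=> [p q] U0 [[A A'] [/= pA qA'] sAU].
  have [C [BC nCp sCA]] := base_nbhs cB pA.
  have [C' [BC' nCq sCA']] := base_nbhs cB' qA'.
  exists (C `*` setT `|` setT `*` C'); split.
  + apply: fin_unionU; apply: fin_union_setX => //; apply: fin_union1;
      exact: base_setT.
  + by move=> [[]|[]].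
  + move=> [x y] nC; apply: sAU; split=> /=; [apply: sCA|apply: sCA'].
      by move=> Cx; apply: nC; left.
    by move=> Cy; apply: nC; right.
- move=> F FU.
  have [p Fp] := base_limit cB (ultra_fmap fst FU).
  have [q Fq] := base_limit cB' (ultra_fmap snd FU).
  exists (p, q) => _ [V BV [W B'W <-]].
  split=> [FVW|[/= Vp Wq]].
    by split; [apply/(Fp _ BV)|apply/(Fq _ B'W)];
      apply: (@filterS _ F _ (V `*` W)) => // -[x y] [].
  have -> : V `*` W = fst @^-1` V `&` snd @^-1` W by [].
  by apply: filterI; [exact/(Fp _ BV)|exact/(Fq _ B'W)].
Qed.

(** * The patch topology *)

Section Patch.
Context {T : topologicalType}.
Implicit Types (U : set T) (F : set_system T).

Lemma patch_cvg F (p : patch_space T) : Filter F ->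
  (forall U, qc_open U \/ qc_open (~` U) -> U p -> F U) -> F --> p.
Proof.
move=> FF Fp W; rewrite nbhsE /= => -[O [[D sD <-] [V DV Vp]] sOW].
apply: filterS sOW _; apply: (@filterS _ _ _ V); first exact: bigcup_sup.
have [E sE VE] := sD _ DV; rewrite -VE in Vp *.
apply: filter_bigI => U EU; apply: Fp; last exact: Vp.
by have := sE _ EU; rewrite inE.
Qed.

Lemma patch_open U :
  qc_open U \/ qc_open (~` U) -> open (U : set (patch_space T)).
Proof.
move=> qU; exists [set U]; last by rewrite bigcup_set1.
by move=> _ ->; exact: (@finI_from1 _ _ _ id).
Qed.

Context (B : set (set T)) (cB : coherent_base B).

Lemma patch_clopen V : B V -> clopen (V : set (patch_space T)).
Proof.
move=> BV.
have qV : qc_open (~` V).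
  by apply/(qc_openP cB); rewrite setCK; exact: fin_union1.
split; first by apply: patch_open; right.
by rewrite -openC; apply: patch_open; left.
Qed.

(** The limit that a coherent base provides decides membership of every
    quasi-compact open set, hence is a limit for the patch topology. *)
Lemma patch_compact : compact [set: patch_space T].
Proof.
rewrite compact_ultra => F FU _; have [p Fp] := base_limit cB FU.
exists p; split=> //; apply: patch_cvg => U qU Up.
have limF C : fin_union B C -> F C <-> C p by exact: ultra_fin_union.
have [/(qc_openP cB) BU|/(qc_openP cB)] := qU.
  by rewrite -[U]setCK; apply/ultra_setC => /(limF _ BU); apply.
by rewrite setCK => BU; apply/limF.
Qed.

End Patch.

Lemma clopen_bigcup_finite (T : topologicalType) (E : set (set T)) :
  finite_set E -> E `<=` clopen -> clopen (\bigcup_(V in E) V).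
Proof.
move=> finE cE; split; first by apply: bigcup_open => V /cE[].
by apply: closed_bigcup => // V /cE[].
Qed.

(** The finiteness statement behind Priestley duality. The last hypothesis
    says that [W] is an up-set for the preorder in which q is above p when q
    lies in all members of [B] through p. For p in [W] the members of [B]
    through p thus intersect inside [W], and since [~` W] is compact finitely
    many of them already do, their intersection being again in [B]. So [W] is a
    union of members of [B], and, being compact, a finite one. *)
Lemma clopen_upset (T : topologicalType) (B : set (set T)) (W : set T) :
  compact [set: T] -> B setT -> setI_closed B -> B `<=` clopen -> clopen W ->
  (forall p q, W p -> (forall V, B V -> V p -> V q) -> W q) ->
  fin_union B W.
Proof.
move=> cT BT BI cB [oW cW] upW.
have compactW (A : set T) : closed A -> compact A.
  by move=> cA; exact: (subclosed_compact cA cT).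
have nbW p : W p -> exists V, [/\ B V, V p & V `<=` W].
  move=> Wp; pose Bp := [set V | B V /\ V p].
  have cov : ~` W `<=` \bigcup_(U in setC @` Bp) U.
    move=> q nWq; apply: contrapT => nq; apply: nWq; apply: upW Wp _ => V BV Vp.
    by apply: contrapT => nVq; apply: nq; exists (~` V) => //; exists V.
  have oBp : setC @` Bp `<=` open.
    by move=> _ [V [/cB[_ cV] _] <-]; exact: closed_openC.
  have [O [finO sO covO]] :=
    compact_open_subcover (compactW _ (open_closedC oW)) oBp cov.
  have sO' : [set ~` U | U in O] `<=` Bp.
    by move=> _ [U /sO[V BpV <-] <-]; rewrite setCK.
  exists (\bigcap_(V in [set ~` U | U in O]) V); split.
  - apply: bigcap_setI_closed => //; first exact: finite_image.
    by move=> V /sO'[].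
  - by move=> V /sO'[].
  - move=> q Vq; apply: contrapT => /covO[U OU Uq].
    by have /(_ Uq) := Vq (~` U) (imageP _ OU).
pose O := [set V | B V /\ V `<=` W].
have cov : W `<=` \bigcup_(V in O) V.
  by move=> p /nbW[V [BV Vp sVW]]; exists V.
have oO : O `<=` open by move=> V [/cB[]].
have [O' [finO' sO' covO']] := compact_open_subcover (compactW _ cW) oO cov.
exists O'; split=> //; first by move=> V /sO'[].
by apply/seteqP; split=> // p [V /sO'[_ sVW] /sVW].
Qed.

(** A subbasic open set of the patch topology or its complement is a finite
    union of members of the base, by [qc_openP]. *)
Lemma patch_continuous (T Z : topologicalType) (B : set (set Z)) (f : T -> Z) :
  coherent_base B -> (forall V, B V -> clopen (f @^-1` V)) ->
  continuous (f : T -> patch_space Z).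
Proof.
move=> cB fB.
have fC C : fin_union B C -> clopen (f @^-1` C).
  move=> [E [finE sE ->]]; rewrite preimage_bigcup.
  have -> : \bigcup_(V in E) f @^-1` V = \bigcup_(W in preimage f @` E) W.
    by rewrite bigcup_image.
  apply: clopen_bigcup_finite; first exact: finite_image.
  by move=> _ [V /sE/fB ? <-].
move=> p; apply: (@patch_cvg Z (f @ p) (f p)) => U qU Up.
apply: open_nbhs_nbhs; split=> //.
have [/(qc_openP cB)/fC[_ cU]|/(qc_openP cB)] := qU.
  by rewrite -closedC preimage_setC.
by rewrite setCK => /fC[].
Qed.

(** * Spectral maps *)

Section SpectralMaps.
Context {T U Z : topologicalType}.
Context (B : set (set T)) (B' : set (set U)) (BZ : set (set Z)).
Hypotheses (cB : coherent_base B) (cB' : coherent_base B').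
Hypothesis cBZ : coherent_base BZ.

(** Preimages commute with unions and complements, so that [qc_openP] in source
    and target reduces spectrality to a test on the base. *)
Lemma spectral_mapP (f : T -> Z) :
  spectral_map f <-> forall V, BZ V -> fin_union B (f @^-1` V).
Proof.
split=> [spf V BV|fB W /(qc_openP cBZ)[E [finE sE WE]]].
  rewrite -[_ @^-1` _]setCK preimage_setC; apply/(qc_openP cB)/spf.
  by apply/(qc_openP cBZ); rewrite setCK; exact: fin_union1.
apply/(qc_openP cB); rewrite preimage_setC WE preimage_bigcup.
by apply: fin_union_bigcup => // V /sE/fB.
Qed.

(** The topology here is the product of the patch topologies, not the patch
    topology of the product. *)
Lemma patch_clopen_setX :
  prod_base B B' `<=` @clopen (patch_space T * patch_space U)%type.
Proof.
move=> _ [V /(patch_clopen cB) cV [W /(patch_clopen cB') cW <-]].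
have -> : V `*` W = fst @^-1` V `&` snd @^-1` W by [].
apply: clopenI; [apply: (preimage_clopen cV)|apply: (preimage_clopen cW)] => p.
  exact: cvg_fst.
exact: cvg_snd.
Qed.

End SpectralMaps.

Lemma spectral_patch_continuous (T U Z : topologicalType) (B : set (set T))
    (B' : set (set U)) (BZ : set (set Z)) (f : T * U -> Z) :
  coherent_base B -> coherent_base B' -> coherent_base BZ ->
  spectral_map f ->
  continuous (f : (patch_space T * patch_space U)%type -> patch_space Z).
Proof.
move=> cB cB' cBZ spf; apply: (patch_continuous cBZ) => V BV.
have /(spectral_mapP (coherent_prod_base cB cB') cBZ) := spf.
move=> /(_ _ BV)[E [finE sE ->]]; apply: clopen_bigcup_finite => // W /sE.
exact: patch_clopen_setX.
Qed.

(** * The space of closed subsets *)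

Section ClosedSpace.
Context {S : Type} (cl : closure_operator S).

Lemma carrier_closed (A : closed_space cl) : cl (carrier A) = carrier A.
Proof. exact: set_mem (valP A). Qed.

Definition above (F : set S) : set (closed_space cl) :=
  [set A | F `<=` carrier A].

Definition above_base : set (set (closed_space cl)) :=
  above @` [set F | finite_set F].

(** Algebraicity enters in the last clause only: if s is in the closure of the
    limit set [P], it is in the closure of a finite part E of [P]; the
    ultrafilter contains [above E], each member of which contains s. *)
Lemma coherent_above_base : algebraic_closure cl -> coherent_base above_base.
Proof.
move=> cl_alg; split.
- exists set0; first exact: finite_set0.
  by apply/seteqP; split=> // A _ x.
- move=> _ _ [F finF <-] [G finG <-]; exists (F `|` G).
    by rewrite /= finite_setU.
  by apply/seteqP; split=> A; rewrite /above /= subUset.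
- move=> _ [F finF <-]; rewrite -openC.
  exists [set A : hull_kernel S | ~ (F `<=` (A : set S))] => //.
  exists [set [set A : hull_kernel S | ~ (F `<=` (A : set S))]].
    move=> _ ->.
    exact: (@finI_from1 _ _ [set F | finite_set F]
      (fun F => [set A : hull_kernel S | ~ (F `<=` (A : set S))])).
  by rewrite bigcup_set1.
- move=> A U; rewrite nbhsE => -[_ [[_ [D sD <-] <-] [V DV VA]] sDU].
  have [E sE VE] := sD _ DV.
  exists (\bigcup_(F in [set` E]) above F); split.
  + apply: fin_union_bigcup; first exact: finite_fset.
    by move=> F /sE/set_mem finF; apply: fin_union1; exists F.
  + by move=> [F EF FA]; rewrite -VE in VA; exact: (VA F EF).
  + move=> A' nA'; apply: sDU.
    have VA' : V (set_val A') by rewrite -VE => F EF FA'; apply: nA'; exists F.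
    by exists V.
- move=> F FU; pose P : set S := [set s | F (above [set s])].
  have finP E : finite_set E -> F (above E) <-> E `<=` P.
    move=> finE; split=> [FE s Es|sEP].
      by apply: filterS FE => A EA _ ->; exact: EA.
    have : F (\bigcap_(s in E) above [set s]) by exact: filter_bigcap.
    by apply: filterS => A EA s Es; exact: (EA s Es).
  have clP : cl P = P.
    apply/seteqP; split; last exact: cl_extensive.
    rewrite cl_alg => s [E [finE /(finP _ finE) FE] Es].
    apply: filterS FE => A EA _ ->; rewrite -carrier_closed.
    exact: cl_monotone Es.
  exists (exist _ P (mem_set clP)) => _ [E finE <-].
  exact: finP.
Qed.

Lemma algebraic_fin (A F : set S) : algebraic_closure cl ->
  finite_set F -> F `<=` cl A ->
  exists E, [/\ finite_set E, E `<=` A & F `<=` cl E].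
Proof.
move=> cl_alg finF sF.
have /choice[E EP] s : exists E, F s -> [/\ finite_set E, E `<=` A & cl E s].
  have [/sF|nFs] := pselect (F s); last by exists set0.
  by rewrite cl_alg => -[E [finE sEA] Es]; exists E.
exists (\bigcup_(s in F) E s); split.
- by apply: bigcup_finite => // s /EP[].
- by move=> t [s /EP[_ sE _] /sE].
- move=> s Fs; have [_ _] := EP s Fs; apply: cl_monotone.
  exact: bigcup_sup.
Qed.

End ClosedSpace.

Arguments above {S} cl F.
Arguments above_base {S} cl.

(** For [W] the preimage of [above F] under [star], the right-hand side is
    condition (3) for F. *)
Lemma above_prodP (S : Type) (cl : closure_operator S)
    (W : set (closed_space cl * closed_space cl)) :
  fin_union (prod_base (above_base cl) (above_base cl)) W <->
  exists (n : nat) (G H : 'I_n -> set S),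
    (forall i, finite_set (G i) /\ finite_set (H i)) /\
    forall A B, W (A, B) <->
      exists i, G i `<=` carrier A /\ H i `<=` carrier B.
Proof.
split=> [[E [/finite_seqP[s sE] EB ->]]|[n [G [H [fin WP]]]]]; last first.
  have -> : W = \bigcup_i (above cl (G i) `*` above cl (H i)).
    apply/seteqP; split=> -[A B] => [/WP[i [? ?]]|[i _ [? ?]]].
      by exists i.
    by apply/WP; exists i.
  apply: fin_union_bigcup => [|i _]; first exact: finite_finset.
  have [finG finH] := fin i; apply: fin_union1.
  exists (above cl (G i)); first exact: imageP finG.
  by exists (above cl (H i)); first exact: imageP finH.
have /choice[GH GHP] V : exists GH : set S * set S, E V ->
    [/\ finite_set GH.1, finite_set GH.2 &
        V = above cl GH.1 `*` above cl GH.2].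
  have [/EB[_ [G finG <-] [_ [H finH <-] <-]]|nEV] := pselect (E V).
    by exists (G, H).
  by exists (set0, set0).
have memE i : E (tnth (in_tuple s) i) by rewrite sE; exact: mem_tnth.
exists (size s), (fun i => (GH (tnth (in_tuple s) i)).1).
exists (fun i => (GH (tnth (in_tuple s) i)).2).
split=> [i|A B]; first by have [] := GHP _ (memE i).
split=> [[V EV VAB]|[i [GA HB]]]; last first.
  by exists (tnth (in_tuple s) i) => //; have [_ _ ->] := GHP _ (memE i).
have /tnthP[i Vi] : V \in in_tuple s by move: EV; rewrite sE.
by exists i; rewrite -Vi; have [_ _ VE] := GHP _ EV; rewrite VE in VAB.
Qed.

(** * The product of closed subsets *)

Section Star.
Context {S : semigroupType} (cl : closure_operator S).
Implicit Types A B : closed_space cl.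

Lemma star_mono A A' B B' :
  carrier A `<=` carrier A' -> carrier B `<=` carrier B' ->
  carrier (star (A, B)) `<=` carrier (star (A', B')).
Proof.
move=> sA sB; apply: cl_monotone => _ [a Aa [b Bb <-]].
by exists a; [exact: sA|exists b; [exact: sB|]].
Qed.

(** By algebraicity [F] lies in the closure of a finite set E of products a * b;
    the left factors occurring in E generate [A0], the right ones [B0]. *)
Lemma sub_star_fin A B (F : set S) : algebraic_closure cl ->
  finite_set F -> F `<=` carrier (star (A, B)) ->
  exists A0 B0, [/\ fin_generated A0, fin_generated B0,
    carrier A0 `<=` carrier A, carrier B0 `<=` carrier B &
    F `<=` carrier (star (A0, B0))].
Proof.
move=> cl_alg finF /(algebraic_fin cl_alg finF)[E [finE sE sF]].
have /choice[f fP] e : exists ab : S * S, E e ->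
    [/\ carrier A ab.1, carrier B ab.2 & (ab.1 * ab.2)%g = e].
  have [/sE[a Aa [b Bb abe]]|nEe] := pselect (E e); first by exists (a, b).
  by exists (e, e).
exists (mk_closed cl [set (f e).1 | e in E]).
exists (mk_closed cl [set (f e).2 | e in E]).
split.
- by exists [set (f e).1 | e in E] => //; exact: finite_image.
- by exists [set (f e).2 | e in E] => //; exact: finite_image.
- rewrite -[X in _ `<=` X]carrier_closed; apply: cl_monotone.
  by move=> _ [e /fP[? _ _] <-].
- rewrite -[X in _ `<=` X]carrier_closed; apply: cl_monotone.
  by move=> _ [e /fP[_ ? _] <-].
- apply: subset_trans sF _; apply: cl_monotone => e Ee.
  have [_ _ fe] := fP _ Ee.
  exists (f e).1; first by apply: cl_extensive; exists e.
  by exists (f e).2 => //; apply: cl_extensive; exists e.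
Qed.

End Star.

Theorem corollary4p9 (d : Order.disp_t) (S : slosType d)
    (cl : closure_operator S) (cl_alg : algebraic_closure cl) :
  [<-> spectral_map (@star S cl);
       continuous (@star S cl :
         (patch_space (closed_space cl) * patch_space (closed_space cl))%type ->
         patch_space (closed_space cl));
       forall F : set S, finite_set F ->
         exists (n : nat) (G H : 'I_n -> set S),
           (forall i, finite_set (G i) /\ finite_set (H i)) /\
           forall A B : closed_space cl,
             F `<=` carrier (star (A, B)) <->
             exists i, G i `<=` carrier A /\ H i `<=` carrier B;
       forall F : set S, finite_set F ->
         exists (n : nat) (G H : 'I_n -> closed_space cl),
           (forall i, fin_generated (G i) /\ fin_generated (H i)) /\
           forall A B : closed_space cl,
             fin_generated A -> fin_generated B ->
             (F `<=` carrier (star (A, B)) <->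
              exists i, carrier (G i) `<=` carrier A /\
                        carrier (H i) `<=` carrier B)].
Proof.
have cB := coherent_above_base cl_alg.
have cBB := coherent_prod_base cB cB.
tfae.
- exact: (spectral_patch_continuous cB cB cB).
- move=> ctn F finF; apply/(above_prodP (@star S cl @^-1` above cl F)).
  apply: (@clopen_upset
    (patch_space (closed_space cl) * patch_space (closed_space cl))%type).
  + rewrite -setXTT; apply: compact_setX; exact: patch_compact cB.
  + exact: base_setT cBB.
  + exact: base_setI cBB.
  + exact: (patch_clopen_setX cB cB).
  + have aF : above_base cl (above cl F) by exists F.
    exact: preimage_clopen (patch_clopen cB aF) ctn.
  (* Rectangles with one factor above a singleton test single elements. *)
  + move=> [A B] [A' B'] /= sF up; apply: subset_trans sF _.
    apply: star_mono => s ss.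
      have [] // := up (above cl [set s] `*` setT).
      * exists (above cl [set s]); first exact: imageP (finite_set1 s).
        by exists setT; first exact: base_setT cB.
      * by split=> // _ ->.
      * by move=> + _; apply.
    have [] // := up (setT `*` above cl [set s]).
    * exists setT; first exact: base_setT cB.
      by exists (above cl [set s]); first exact: imageP (finite_set1 s).
    * by split=> // _ ->.
    * by move=> _; apply.
- move=> fin3 F finF; have [n [G [H [finGH GHP]]]] := fin3 F finF.
  exists n, (fun i => mk_closed cl (G i)), (fun i => mk_closed cl (H i)).
  have mkP C (A : closed_space cl) :
      carrier (mk_closed cl C) `<=` carrier A <-> C `<=` carrier A.
    split=> [sCA|sCA]; first exact: subset_trans (@cl_extensive _ cl C) sCA.
    by rewrite -[carrier A]carrier_closed; exact: cl_monotone.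
  split=> [i|A B _ _].
    by have [? ?] := finGH i; split; [exists (G i)|exists (H i)].
  apply: (iff_trans (GHP A B)).
  by split=> -[i [? ?]]; exists i; split; apply/mkP.
- move=> fin4; apply/(spectral_mapP cBB cB) => _ [F finF <-].
  apply/above_prodP; have [n [G [H [fgGH GHP]]]] := fin4 F finF.
  have /choice[g gP] i : exists F', finite_set F' /\ carrier (G i) = cl F'.
    by have [[F' ? ?] _] := fgGH i; exists F'.
  have /choice[h hP] i : exists F', finite_set F' /\ carrier (H i) = cl F'.
    by have [_ [F' ? ?]] := fgGH i; exists F'.
  exists n, g, h; split=> [i|A B].
    by split; [case: (gP i)|case: (hP i)].
  split=> [sF|[i [gA hB]]].
    have [A0 [B0 [fgA fgB sA sB]]] := sub_star_fin cl_alg finF sF.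
    move=> /(GHP _ _ fgA fgB)[i [GA HB]]; exists i.
    have [_ GE] := gP i; have [_ HE] := hP i; split.
      apply: subset_trans sA; apply: subset_trans GA.
      by rewrite GE; exact: cl_extensive.
    apply: subset_trans sB; apply: subset_trans HB.
    by rewrite HE; exact: cl_extensive.
  have [fgG fgH] := fgGH i; have [_ GE] := gP i; have [_ HE] := hP i.
  have : F `<=` carrier (star (G i, H i)).
    by apply/(GHP _ _ fgG fgH); exists i; split; exact: subset_refl.
  move=> /subset_trans; apply; apply: star_mono.
    by rewrite GE -carrier_closed; exact: cl_monotone.
  by rewrite HE -carrier_closed; exact: cl_monotone.
Qed.
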